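(* Let $\mathbb A$ be a distributive monoidal category. In the free cornering with choice $\ulcorner\mathbb A\urcorner^{\oplus}$, for all cells $\alpha:(U;A;C;W)$ and $\beta:(U;B;C;W)$, and all cells $\gamma$ of suitable type for the composites below to be defined (i.e. $\gamma$ with right boundary $U$ in (i), left boundary $W$ in (ii), and top boundary $C$ in (iii)): (i) $\gamma\mid[\alpha,\beta]=\dfrac{\delta^l}{[(\gamma\mid\alpha),(\gamma\mid\beta)]}$; (ii) $[\alpha,\beta]\mid\gamma=\dfrac{\delta^r}{[(\alpha\mid\gamma),(\beta\mid\gamma)]}$; (iii) $\dfrac{[\alpha,\beta]}{\gamma}=\left[\dfrac{\alpha}{\gamma},\dfrac{\beta}{\gamma}\right]$.
   Context: Monoidal categories are strict, and composites are in diagrammatic order ($fg$ is first $f$, then $g$). A single-object double category $\mathbb D$ has a horizontal edge monoid $(\mathbb D_H,\otimes,I)$, a vertical edge monoid $(\mathbb D_V,\otimes,I)$, and for $A,B\in\mathbb D_H$, $U,W\in\mathbb D_V$ a set of cells $(U;A;B;W)$ (left; top; bottom; right boundary). For $\alpha:(U;A;B;V)$ and $\beta:(V;A';B';W)$ there is a horizontal composite $\alpha\mid\beta:(U;A\otimes A';B\otimes B';W)$; for $\alpha:(U;A;C;W)$ and $\beta:(U';C;B;W')$ a vertical composite $\frac{\alpha}{\beta}:(U\otimes U';A;B;W\otimes W')$. Both are associative and unital, with horizontal units $id_U:(U;I;I;U)$ and vertical units $1_A:(I;A;A;I)$, where $id_I=1_I$, $1_{A\otimes B}=1_A\mid 1_B$,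 $id_{U\otimes W}=\frac{id_U}{id_W}$, and interchange $\frac{\alpha}{\beta}\mid\frac{\gamma}{\delta}=\frac{\alpha\mid\gamma}{\beta\mid\delta}$ holds. A distributive monoidal category $(\mathbb A,\otimes,\oplus,I)$ is a symmetric monoidal category with binary coproducts $A\oplus B$ (injections $\sigma_0,\sigma_1$, copairing $[f,g]$; no initial object required) such that $\mu^r=[\sigma_0\otimes 1_C,\sigma_1\otimes 1_C]:(A\otimes C)\oplus(B\otimes C)\to(A\oplus B)\otimes C$ has an inverse $\delta^r$ for all $A,B,C$. Then also $\mu^l=[1_C\otimes\sigma_0,1_C\otimes\sigma_1]:(C\otimes A)\oplus(C\otimes B)\to C\otimes(A\oplus B)$ has an inverse $\delta^l$. In the claim $\delta^r,\delta^l$ denote the cells $\ulcorner\delta^r\urcorner,\ulcorner\delta^l\urcorner$ of the appropriate type. Exchanges with choice: $\mathbb A^{\circ\bullet}_\oplus$ is the monoid (operation $\otimes$, unit $I$) with elements generated by $A^\circ$, $A^\bullet$ ($A\in\mathbb A_0$), $I$, $U\otimes W$, $U\times W$, $U+W$, subject only to associativity and unitality of $\otimes$. Free cornering with choice: $\ulcorner\mathbb A\urcorner^{\oplus}$ is the free single-object double category with horizontal edge monoid $(\mathbb A_0,\otimes,I)$, vertical edge monoid $\mathbb A^{\circ\bullet}_\oplus$, and generating cells and equations: (1) for each $f:A\to B$ in $\mathbb A$ a cell $\ulcorner f\urcorner:(I;A;B;I)$ (also written $f$), with $\ulcorner fg\urcorner=\frac{\ulcorner f\urcorner}{\ulcorner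 g\urcorner}$, $\ulcorner 1_A\urcorner=1_A$, $\ulcorner f\otimes g\urcorner=\ulcorner f\urcorner\mid\ulcorner g\urcorner$; (2) for each $A\in\mathbb A_0$ corner cells $\mathsf{get}_L^A:(A^\circ;I;A;I)$, $\mathsf{put}_R^A:(I;A;I;A^\circ)$, $\mathsf{get}_R^A:(I;I;A;A^\bullet)$, $\mathsf{put}_L^A:(A^\bullet;A;I;I)$ with $\mathsf{put}_R^A\mid\mathsf{get}_L^A=1_A$, $\frac{\mathsf{get}_L^A}{\mathsf{put}_R^A}=id_{A^\circ}$, $\mathsf{get}_R^A\mid\mathsf{put}_L^A=1_A$, $\frac{\mathsf{get}_R^A}{\mathsf{put}_L^A}=id_{A^\bullet}$; (3) for all $U,W$, cells $\pi_0:(U\times W;I;I;U)$, $\pi_1:(U\times W;I;I;W)$, and for $\alpha:(V;A;B;U)$, $\beta:(V;A;B;W)$ a unique cell $\alpha\times\beta:(V;A;B;U\times W)$ with $(\alpha\times\beta)\mid\pi_0=\alpha$, $(\alpha\times\beta)\mid\pi_1=\beta$; (4) for all $U,W$, cells $\iota_0:(U;I;I;U+W)$, $\iota_1:(W;I;I;U+W)$, and for $\alpha:(U;A;B;V)$, $\beta:(W;A;B;V)$ a unique cell $\alpha+\beta:(U+W;A;B;V)$ with $\iota_0\mid(\alpha+\beta)=\alpha$, $\iota_1\mid(\alpha+\beta)=\beta$; (5) for $\alpha:(U;A;C;W)$, $\beta:(U;B;C;W)$ a unique cell $[\alpha,\beta]:(U;A\oplus B;C;W)$ with $\frac{\ulcorner\sigma_0\urcorner}{[\alpha,\beta]}=\alpha$,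 $\frac{\ulcorner\sigma_1\urcorner}{[\alpha,\beta]}=\beta$. *)

(* Defs.v *)
From Stdlib Require Import List Setoid Relations RelationClasses.
Import ListNotations.

Set Implicit Arguments.
Unset Strict Implicit.
Unset Printing Implicit Defensive.

(** Composition is in diagrammatic order.  Strictness is equality of objects,
    so the associativity and unit laws for the tensor of morphisms are stated
    after transport along these equalities. *)

Definition hcast {O : Type} {hom : O -> O -> Type} {A A' B B' : O}
  (eA : A = A') (eB : B = B') (f : hom A B) : hom A' B' :=
  match eA in _ = X, eB in _ = Y return hom X Y with
  | eq_refl, eq_refl => f
  end.

Record symMonCat := SymMonCat {
  ob :> Type;
  hom : ob -> ob -> Type;
  idm : forall A, hom A A;
  comp : forall A B C, hom A B -> hom B C -> hom A C;
  tens : ob -> ob -> ob;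
  unit : ob;
  tensm : forall A B A' B',
    hom A B -> hom A' B' -> hom (tens A A') (tens B B');
  braid : forall A B, hom (tens A B) (tens B A);

  compA : forall A B C D (f : hom A B) (g : hom B C) (h : hom C D),
    comp (comp f g) h = comp f (comp g h);
  comp1m : forall A B (f : hom A B), comp (idm A) f = f;
  compm1 : forall A B (f : hom A B), comp f (idm B) = f;

  tensA : forall A B C, tens (tens A B) C = tens A (tens B C);
  tens1o : forall A, tens unit A = A;
  tenso1 : forall A, tens A unit = A;

  tensm_id : forall A B, tensm (idm A) (idm B) = idm (tens A B);
  tensm_comp : forall A B C A' B' C'
      (f : hom A B) (g : hom B C) (f' : hom A' B') (g' : hom B' C'),
    tensm (comp f g) (comp f' g') = comp (tensm f f') (tensm g g');
  tensmA : forall A B A' B' A'' B''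
      (f : hom A B) (g : hom A' B') (h : hom A'' B''),
    hcast (tensA A A' A'') (tensA B B' B'') (tensm (tensm f g) h)
    = tensm f (tensm g h);
  tensm1m : forall A B (f : hom A B),
    hcast (tens1o A) (tens1o B) (tensm (idm unit) f) = f;
  tensmm1 : forall A B (f : hom A B),
    hcast (tenso1 A) (tenso1 B) (tensm f (idm unit)) = f;

  braid_nat : forall A B A' B' (f : hom A B) (g : hom A' B'),
    comp (tensm f g) (braid B B') = comp (braid A A') (tensm g f);
  braid_sym : forall A B, comp (braid A B) (braid B A) = idm (tens A B);
  braid_hex : forall A B C,
    hcast eq_refl (tensA B C A) (braid A (tens B C))
    = comp (hcast (tensA A B C) (tensA B A C) (tensm (braid A B) (idm C)))
           (tensm (idm B) (braid A C))
}.

Arguments idm {s} A.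
Arguments unit {s}.
Arguments braid {s} A B.

Record distrMonCat := DistrMonCat {
  smc :> symMonCat;
  oplus : smc -> smc -> smc;
  inj0 : forall A B, hom A (oplus A B);
  inj1 : forall A B, hom B (oplus A B);
  copairm : forall A B C, hom A C -> hom B C -> hom (oplus A B) C;
  inj0_copairm : forall A B C (f : hom A C) (g : hom B C),
    comp (inj0 A B) (copairm f g) = f;
  inj1_copairm : forall A B C (f : hom A C) (g : hom B C),
    comp (inj1 A B) (copairm f g) = g;
  copairm_uniq : forall A B C (f : hom A C) (g : hom B C)
      (h : hom (oplus A B) C),
    comp (inj0 A B) h = f -> comp (inj1 A B) h = g -> h = copairm f g;

  (* a definition, not a further field *)
  mur : forall A B C,
      hom (oplus (tens A C) (tens B C)) (tens (oplus A B) C)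
    := fun A B C =>
      copairm (tensm (inj0 A B) (idm C)) (tensm (inj1 A B) (idm C));
  deltar : forall A B C,
    hom (tens (oplus A B) C) (oplus (tens A C) (tens B C));
  mur_deltar : forall A B C, comp (mur A B C) (deltar A B C) = idm _;
  deltar_mur : forall A B C, comp (deltar A B C) (mur A B C) = idm _
}.

Arguments inj0 {d} A B.
Arguments inj1 {d} A B.
Arguments mur {d} A B C.
Arguments deltar {d} A B C.

Section LeftDistributivity.
Variable A : distrMonCat.
Implicit Types a b c d : A.

Definition mul a b c : hom (oplus (tens c a) (tens c b)) (tens c (oplus a b)) :=
  copairm (tensm (idm c) (inj0 a b)) (tensm (idm c) (inj1 a b)).

(** The inverse of [mul], obtained from [deltar] by conjugating with the
    symmetry; see [mul_deltal] and [deltal_mul]. *)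
Definition deltal a b c :
    hom (tens c (oplus a b)) (oplus (tens c a) (tens c b)) :=
  comp (braid c (oplus a b))
    (comp (deltar a b c)
      (copairm (comp (braid a c) (inj0 (tens c a) (tens c b)))
               (comp (braid b c) (inj1 (tens c a) (tens c b))))).

Lemma copairm_ext a b c (f g : hom (oplus a b) c) :
  comp (inj0 a b) f = comp (inj0 a b) g ->
  comp (inj1 a b) f = comp (inj1 a b) g -> f = g.
Proof.
intros H0 H1.
rewrite (copairm_uniq H0 H1); symmetry; now apply copairm_uniq.
Qed.

Lemma mul_braid a b c :
  comp (mul a b c) (braid c (oplus a b))
  = comp (copairm (comp (braid c a) (inj0 (tens a c) (tens b c)))
                  (comp (braid c b) (inj1 (tens a c) (tens b c))))
         (mur a b c).
Proof.
apply copairm_ext; unfold mul, mur; rewrite <- !compA.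
- now rewrite !inj0_copairm, braid_nat, compA, inj0_copairm.
- now rewrite !inj1_copairm, braid_nat, compA, inj1_copairm.
Qed.

Lemma mul_deltal a b c : comp (mul a b c) (deltal a b c) = idm _.
Proof.
unfold deltal.
rewrite <- compA, mul_braid, compA, <- (compA (mur _ _ _)).
rewrite mur_deltar, comp1m.
apply copairm_ext; rewrite <- compA, compm1.
- now rewrite inj0_copairm, compA, inj0_copairm, <- compA, braid_sym, comp1m.
- now rewrite inj1_copairm, compA, inj1_copairm, <- compA, braid_sym, comp1m.
Qed.

Lemma deltal_mul a b c : comp (deltal a b c) (mul a b c) = idm _.
Proof.
assert (E : comp (copairm (comp (braid a c) (inj0 (tens c a) (tens c b)))
                          (comp (braid b c) (inj1 (tens c a) (tens c b))))
                 (mul a b c)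
            = comp (mur a b c) (braid (oplus a b) c)).
{ apply copairm_ext; unfold mul, mur; rewrite <- !compA.
  - now rewrite !inj0_copairm, compA, inj0_copairm, braid_nat.
  - now rewrite !inj1_copairm, compA, inj1_copairm, braid_nat. }
unfold deltal.
now rewrite !compA, E, <- (compA (deltar _ _ _)), deltar_mur, comp1m, braid_sym.
Qed.

End LeftDistributivity.

Arguments mul {A} a b c.
Arguments deltal {A} a b c.

(** A monoid presented by generators, subject only to associativity and
    unitality, is the free monoid on those generators: the tensor is
    concatenation and the unit is the empty list.  The generators are
    themselves formed from exchanges by [Times] and [Plus]. *)

Inductive atom (O : Type) : Type :=
| Circ : O -> atom O
| Bullet : O -> atom O
| Times : list (atom O) -> list (atom O) -> atom O
| Plus : list (atom O) -> list (atom O) -> atom O.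

Definition exch (O : Type) : Type := list (atom O).

Section Exchanges.
Variable O : Type.

Definition exI : exch O := [].
Definition exT (U W : exch O) : exch O := U ++ W.
Definition circ (A : O) : exch O := [Circ A].
Definition bullet (A : O) : exch O := [Bullet A].
Definition times (U W : exch O) : exch O := [Times U W].
Definition plus (U W : exch O) : exch O := [Plus U W].

(* [exT exI U] is [U] by computation, as is [exT U exI] for a single generator
   [U], so cells with such boundaries need no cast below.  The general laws are
   proved transparently so that the casts along them compute. *)
Lemma exTA (U V W : exch O) : exT (exT U V) W = exT U (exT V W).
Proof.
induction U as [|x U IH]; [reflexivity | exact (f_equal (cons x) IH)].
Defined.
Lemma exTo1 (U : exch O) : exT U exI = U.
Proof.
induction U as [|x U IH]; [reflexivity | exact (f_equal (cons x) IH)].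
Defined.

End Exchanges.

Arguments exI {O}.

(** The free single-object double category on the given cells and equations is
    presented by generators and relations: [cell U A B W] is the type of
    formal composites with left, top, bottom and right boundary [U], [A], [B]
    and [W], and two such composites denote the same cell of the free cornering
    exactly when they are related by [ceq], the least congruence containing the
    double category laws and the defining equations.  The uniqueness clauses of
    the universal properties are the rules [cprod_uniq], [csum_uniq] and
    [copair_uniq]. *)

Section Cornering.
Variable A : distrMonCat.
Implicit Types a b c : A.
Implicit Types U V W : exch A.

Inductive cell : exch A -> A -> A -> exch A -> Type :=
| hcomp U V W a b a' b' :
    cell U a b V -> cell V a' b' W -> cell U (tens a a') (tens b b') W
| vcomp U U' W W' a b c :
    cell U a c W -> cell U' c b W' -> cell (exT U U') a b (exT W W')
| hid U : cell U unit unit U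
| vid a : cell exI a a exI
| corner a b : hom a b -> cell exI a b exI
| getL a : cell (circ a) unit a exI
| putR a : cell exI a unit (circ a)
| getR a : cell exI unit a (bullet a)
| putL a : cell (bullet a) a unit exI
| proj0 U W : cell (times U W) unit unit U
| proj1 U W : cell (times U W) unit unit W
| cprod U V W a b : cell V a b U -> cell V a b W -> cell V a b (times U W)
| iota0 U W : cell U unit unit (plus U W)
| iota1 U W : cell W unit unit (plus U W)
| csum U V W a b : cell U a b V -> cell W a b V -> cell (plus U W) a b V
| copair U W a b c :
    cell U a c W -> cell U b c W -> cell U (oplus a b) c W.

Definition ccast U U' a a' b b' W W'
    (eU : U = U') (ea : a = a') (eb : b = b') (eW : W = W')
    (x : cell U a b W) : cell U' a' b' W' :=
  match eU in _ = X, ea in _ = Y, eb in _ = Z, eW in _ = T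
    return cell X Y Z T
  with
  | eq_refl, eq_refl, eq_refl, eq_refl => x
  end.

Definition castH U W a a' b b' (ea : a = a') (eb : b = b')
  : cell U a b W -> cell U a' b' W := ccast eq_refl ea eb eq_refl.
Definition castV U U' W W' a b (eU : U = U') (eW : W = W')
  : cell U a b W -> cell U' a b W' := ccast eU eq_refl eq_refl eW.

Inductive ceq : forall U a b W, cell U a b W -> cell U a b W -> Prop :=
| ceq_refl U a b W (x : cell U a b W) : ceq x x
| ceq_sym U a b W (x y : cell U a b W) : ceq x y -> ceq y x
| ceq_trans U a b W (x y z : cell U a b W) : ceq x y -> ceq y z -> ceq x z
| ceq_hcomp U V W a b a' b' (x x' : cell U a b V) (y y' : cell V a' b' W) :
    ceq x x' -> ceq y y' -> ceq (hcomp x y) (hcomp x' y')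
| ceq_vcomp U U' W W' a b c (x x' : cell U a c W) (y y' : cell U' c b W') :
    ceq x x' -> ceq y y' -> ceq (vcomp x y) (vcomp x' y')
| ceq_cprod U V W a b (x x' : cell V a b U) (y y' : cell V a b W) :
    ceq x x' -> ceq y y' -> ceq (cprod x y) (cprod x' y')
| ceq_csum U V W a b (x x' : cell U a b V) (y y' : cell W a b V) :
    ceq x x' -> ceq y y' -> ceq (csum x y) (csum x' y')
| ceq_copair U W a b c (x x' : cell U a c W) (y y' : cell U b c W) :
    ceq x x' -> ceq y y' -> ceq (copair x y) (copair x' y')
| hcompA U V V' W a b a' b' a'' b''
    (x : cell U a b V) (y : cell V a' b' V') (z : cell V' a'' b'' W) :
    ceq (castH (tensA a a' a'') (tensA b b' b'') (hcomp (hcomp x y) z))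
        (hcomp x (hcomp y z))
| hcomp1c U W a b (x : cell U a b W) :
    ceq (castH (tens1o a) (tens1o b) (hcomp (hid U) x)) x
| hcompc1 U W a b (x : cell U a b W) :
    ceq (castH (tenso1 a) (tenso1 b) (hcomp x (hid W))) x
| vcompA U U' U'' W W' W'' a b c d
    (x : cell U a b W) (y : cell U' b c W') (z : cell U'' c d W'') :
    ceq (castV (exTA U U' U'') (exTA W W' W'') (vcomp (vcomp x y) z))
        (vcomp x (vcomp y z))
| vcomp1c U W a b (x : cell U a b W) :
    ceq (vcomp (vid a) x : cell U a b W) x
| vcompc1 U W a b (x : cell U a b W) :
    ceq (castV (exTo1 U) (exTo1 W) (vcomp x (vid b))) x
| hid_vid : ceq (hid exI) (vid unit)
| vid_tens a b : ceq (vid (tens a b)) (hcomp (vid a) (vid b))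
| hid_tens U W : ceq (hid (exT U W)) (vcomp (hid U) (hid W))
| interchange U U' V V' W W' a b c a' b' c'
    (x : cell U a c V) (y : cell U' c b V')
    (z : cell V a' c' W) (t : cell V' c' b' W') :
    ceq (hcomp (vcomp x y) (vcomp z t)) (vcomp (hcomp x z) (hcomp y t))
| corner_comp a b c (f : hom a b) (g : hom b c) :
    ceq (corner (comp f g)) (vcomp (corner f) (corner g))
| corner_id a : ceq (corner (idm a)) (vid a)
| corner_tens a b a' b' (f : hom a b) (g : hom a' b') :
    ceq (corner (tensm f g)) (hcomp (corner f) (corner g))
| putR_getL a :
    ceq (castH (tenso1 a) (tens1o a) (hcomp (putR a) (getL a))) (vid a)
| getL_putR a :
    ceq (vcomp (getL a) (putR a)) (hid (circ a))
| getR_putL a :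
    ceq (castH (tens1o a) (tenso1 a) (hcomp (getR a) (putL a))) (vid a)
| getR_putL_v a :
    ceq (vcomp (getR a) (putL a)) (hid (bullet a))
| cprod_proj0 U V W a b (x : cell V a b U) (y : cell V a b W) :
    ceq (castH (tenso1 a) (tenso1 b) (hcomp (cprod x y) (proj0 U W))) x
| cprod_proj1 U V W a b (x : cell V a b U) (y : cell V a b W) :
    ceq (castH (tenso1 a) (tenso1 b) (hcomp (cprod x y) (proj1 U W))) y
| cprod_uniq U V W a b (x : cell V a b U) (y : cell V a b W)
    (z : cell V a b (times U W)) :
    ceq (castH (tenso1 a) (tenso1 b) (hcomp z (proj0 U W))) x ->
    ceq (castH (tenso1 a) (tenso1 b) (hcomp z (proj1 U W))) y ->
    ceq z (cprod x y)
| iota0_csum U V W a b (x : cell U a b V) (y : cell W a b V) :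
    ceq (castH (tens1o a) (tens1o b) (hcomp (iota0 U W) (csum x y))) x
| iota1_csum U V W a b (x : cell U a b V) (y : cell W a b V) :
    ceq (castH (tens1o a) (tens1o b) (hcomp (iota1 U W) (csum x y))) y
| csum_uniq U V W a b (x : cell U a b V) (y : cell W a b V)
    (z : cell (plus U W) a b V) :
    ceq (castH (tens1o a) (tens1o b) (hcomp (iota0 U W) z)) x ->
    ceq (castH (tens1o a) (tens1o b) (hcomp (iota1 U W) z)) y ->
    ceq z (csum x y)
| inj0_copair U W a b c (x : cell U a c W) (y : cell U b c W) :
    ceq (vcomp (corner (inj0 a b)) (copair x y) : cell U _ c W) x
| inj1_copair U W a b c (x : cell U a c W) (y : cell U b c W) :
    ceq (vcomp (corner (inj1 a b)) (copair x y) : cell U _ c W) y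
| copair_uniq U W a b c (x : cell U a c W) (y : cell U b c W)
    (z : cell U (oplus a b) c W) :
    ceq (vcomp (corner (inj0 a b)) z : cell U _ c W) x ->
    ceq (vcomp (corner (inj1 a b)) z : cell U _ c W) y ->
    ceq z (copair x y).

#[export] Instance ceq_equivalence U a b W : Equivalence (@ceq U a b W).
Proof.
split.
- exact (@ceq_refl U a b W).
- exact (@ceq_sym U a b W).
- exact (@ceq_trans U a b W).
Qed.

End Cornering.

Arguments corner {A a b} _.
Arguments castV {A U U' W W' a b} eU eW _.
Arguments castH {A U W a a' b b'} ea eb _.

Notation "x ≡ y" := (ceq x y) (at level 70, no associativity).

(* Main.v *)
(** Universality of copairing makes precomposition with [mul] (resp. [mur]) send
    both sides of (i) (resp. (ii)) to the same copairing, by interchange; and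
    that precomposition is invertible, with inverse given by [deltal] (resp.
    [deltar]).  Every composite whose upper cell comes from [A] has left and
    right boundary [exT exI U], which is [U] by computation, so no cast occurs. *)

Require Import Defs.

Set Implicit Arguments.
Unset Strict Implicit.

Section CopairDistributivity.
Variable A : distrMonCat.
Implicit Types a b c d e : A.
Implicit Types U V W : exch A.

(** The upper cell has side boundaries [exI], and [exTA exI U U'] computes to [eq_refl], so the cast
    in [vcompA] vanishes by conversion. *)
Lemma vcomp_cornerA a b U W c d (f : hom a b) (x : cell U b c W)
    U' W' (y : cell U' c d W') :
  (vcomp (corner f) (vcomp x y) : cell (exT U U') a d (exT W W'))
  ≡ vcomp (vcomp (corner f) x : cell U a c W) y.
Proof. symmetry; exact (vcompA (corner f) x y). Qed.

Lemma vcomp_corner_comp a b c U W d (f : hom a b) (g : hom b c)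
    (x : cell U c d W) :
  (vcomp (corner f) (vcomp (corner g) x : cell U b d W) : cell U a d W)
  ≡ vcomp (corner (comp f g)) x.
Proof.
transitivity (vcomp (vcomp (corner f) (corner g)) x : cell U a d W).
- exact (vcomp_cornerA f (corner g) x).
- exact (ceq_vcomp (ceq_sym (corner_comp f g)) (ceq_refl x)).
Qed.

Lemma vcomp_corner_idm a U W d (x : cell U a d W) :
  (vcomp (corner (idm a)) x : cell U a d W) ≡ x.
Proof.
transitivity (vcomp (vid a) x : cell U a d W).
- exact (ceq_vcomp (corner_id a) (ceq_refl x)).
- exact (vcomp1c x).
Qed.

Lemma vcomp_corner_tensm a b a' b' U V W c c' (f : hom a b) (g : hom a' b')
    (x : cell U b c V) (y : cell V b' c' W) :
  (vcomp (corner (tensm f g)) (hcomp x y) : cell U _ _ W)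
  ≡ hcomp (vcomp (corner f) x : cell U a c V)
          (vcomp (corner g) y : cell V a' c' W).
Proof.
transitivity (vcomp (hcomp (corner f) (corner g)) (hcomp x y) : cell U _ _ W).
- exact (ceq_vcomp (corner_tens f g) (ceq_refl _)).
- symmetry; exact (interchange (corner f) x (corner g) y).
Qed.

(** Insert [g] followed by [f], an identity, above [x]. Used to move [deltal] or [deltar] to the
    other side as [mul] or [mur]. *)
Lemma vcomp_corner_inverse a b U W c (f : hom a b) (g : hom b a)
    (x : cell U b c W) (y : cell U a c W) :
  comp g f = idm b -> (vcomp (corner f) x : cell U a c W) ≡ y ->
  x ≡ (vcomp (corner g) y : cell U b c W).
Proof.
intros gf fx.
transitivity (vcomp (corner g) (vcomp (corner f) x : cell U a c W)
              : cell U b c W).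
- symmetry; etransitivity; [exact (vcomp_corner_comp g f x) |].
  rewrite gf; exact (vcomp_corner_idm x).
- exact (ceq_vcomp (ceq_refl (corner g)) fx).
Qed.

(** The fusion law of coproducts, by uniqueness: each injection absorbed into [copairm f g] leaves
    [f] or [g]. *)
Lemma vcomp_copairm a b c U W d (f : hom a c) (g : hom b c)
    (x : cell U c d W) :
  (vcomp (corner (copairm f g)) x : cell U (oplus a b) d W)
  ≡ copair (vcomp (corner f) x : cell U a d W)
           (vcomp (corner g) x : cell U b d W).
Proof.
apply copair_uniq.
- etransitivity; [exact (vcomp_corner_comp (inj0 a b) (copairm f g) x) |].
  rewrite inj0_copairm; reflexivity.
- etransitivity; [exact (vcomp_corner_comp (inj1 a b) (copairm f g) x) |].
  rewrite inj1_copairm; reflexivity.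
Qed.

Lemma hcomp_copair U V W a b c d e (gamma : cell V d e U)
    (alpha : cell U a c W) (beta : cell U b c W) :
  hcomp gamma (copair alpha beta)
  ≡ vcomp (corner (deltal a b d))
          (copair (hcomp gamma alpha) (hcomp gamma beta)).
Proof.
apply (vcomp_corner_inverse (deltal_mul a b d)).
(* [mul] unfolds to a [copairm] of tensors of an identity with an injection; interchange then sends
   the identity to [gamma] and the injection to the copairing. *)
etransitivity; [apply vcomp_copairm |].
apply ceq_copair; (etransitivity; [apply vcomp_corner_tensm |]);
  apply ceq_hcomp.
- exact (vcomp_corner_idm gamma).
- exact (inj0_copair alpha beta).
- exact (vcomp_corner_idm gamma).
- exact (inj1_copair alpha beta).
Qed.

Lemma copair_hcomp U V W a b c d e (alpha : cell U a c W) (beta : cell U b c W)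
    (gamma : cell W d e V) :
  hcomp (copair alpha beta) gamma
  ≡ vcomp (corner (deltar a b d))
          (copair (hcomp alpha gamma) (hcomp beta gamma)).
Proof.
apply (vcomp_corner_inverse (deltar_mur a b d)).
(* The mirror image: in [mur] the injections stand on the left, above the copairing. *)
etransitivity; [apply vcomp_copairm |].
apply ceq_copair; (etransitivity; [apply vcomp_corner_tensm |]);
  apply ceq_hcomp.
- exact (inj0_copair alpha beta).
- exact (vcomp_corner_idm gamma).
- exact (inj1_copair alpha beta).
- exact (vcomp_corner_idm gamma).
Qed.

(** By uniqueness: after reassociation, an injection placed on top meets only the copairing and
    selects [alpha] or [beta]. *)
Lemma copair_vcomp U W U' W' a b c d (alpha : cell U a c W)
    (beta : cell U b c W) (gamma : cell U' c d W') :
  vcomp (copair alpha beta) gamma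
  ≡ copair (vcomp alpha gamma) (vcomp beta gamma).
Proof.
apply copair_uniq; (etransitivity; [apply vcomp_cornerA |]).
- exact (ceq_vcomp (inj0_copair alpha beta) (ceq_refl gamma)).
- exact (ceq_vcomp (inj1_copair alpha beta) (ceq_refl gamma)).
Qed.

End CopairDistributivity.

Theorem lemma8 (A : distrMonCat) (U W : exch A) (a b c : A)
    (alpha : cell U a c W) (beta : cell U b c W) :
  (forall (V : exch A) (d e : A) (gamma : cell V d e U),
     hcomp gamma (copair alpha beta)
     ≡ vcomp (corner (deltal a b d))
             (copair (hcomp gamma alpha) (hcomp gamma beta)))
  /\
  (forall (V : exch A) (d e : A) (gamma : cell W d e V),
     hcomp (copair alpha beta) gamma
     ≡ vcomp (corner (deltar a b d))
             (copair (hcomp alpha gamma) (hcomp beta gamma)))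
  /\
  (forall (U' W' : exch A) (d : A) (gamma : cell U' c d W'),
     vcomp (copair alpha beta) gamma
     ≡ copair (vcomp alpha gamma) (vcomp beta gamma)).
Proof.
split; [| split]; intros.
- apply hcomp_copair.
- apply copair_hcomp.
- apply copair_vcomp.
Qed.
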